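(* Let $a,b$ be positive integers, $g=\gcd(a,b)$, $e$ an integer with $1\le e\le g-1$, and let $I=(x^a,\;x^{e(a/g)}y^{b-e(b/g)},\;y^b)\subset K[x,y]$. Then $$r(I)=\frac{g}{\gcd(e,g)}-1.$$
   Context: $K$ is a field. With $J=(x^a,y^b)$, the reduction number $r(I)$ is the smallest integer $r\ge0$ with $I^{r+1}=JI^r$ (such $r$ exists for the ideals considered). *)

(* Defs.v *)
From mathcomp Require Import all_boot all_order all_algebra.
From mathcomp Require Import mpoly.

Set Implicit Arguments.
Unset Strict Implicit.
Unset Printing Implicit Defensive.

Import GRing.Theory.
Local Open Scope ring_scope.

(* Ideals are sets in Prop, because membership need not be decidable;         *)
(* MathComp's own idealr structure is restricted to boolean predicates.       *)
Definition ideal_gen (R : comNzRingType) (s : seq R) : R -> Prop :=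
  fun f => exists c : 'I_(size s) -> R, f = \sum_(i < size s) c i * s`_i.

Definition ideal_mul (R : comNzRingType) (I J : R -> Prop) : R -> Prop :=
  fun f => exists (n : nat) (u v : 'I_n -> R),
    (forall i, I (u i) /\ J (v i)) /\ f = \sum_(i < n) u i * v i.

(* I^0 is the unit ideal. *)
Fixpoint ideal_exp (R : comNzRingType) (I : R -> Prop) (n : nat) : R -> Prop :=
  if n is m.+1 then ideal_mul I (ideal_exp I m) else fun _ => True.

Definition ideal_eq (R : comNzRingType) (I J : R -> Prop) : Prop :=
  forall f, I f <-> J f.

(* Stated as a relation: it says that the reduction number of I with respect  *)
(* to J exists and equals r.                                                  *)
Definition is_reduction_number (R : comNzRingType) (J I : R -> Prop) (r : nat)
    : Prop :=
  ideal_eq (ideal_exp I r.+1) (ideal_mul J (ideal_exp I r)) /\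
  (forall s : nat,
     ideal_eq (ideal_exp I s.+1) (ideal_mul J (ideal_exp I s)) -> (r <= s)%N).

Definition varx (K : fieldType) : {mpoly K[2]} := 'X_(ord0 : 'I_2).
Definition vary (K : fieldType) : {mpoly K[2]} := 'X_(ord_max : 'I_2).

(* Main.v *)
Require Import Defs.
From mathcomp Require Import all_boot all_order all_algebra.
From mathcomp Require Import mpoly.
From mathcomp Require Import zify ring.

Set Implicit Arguments.
Unset Strict Implicit.
Unset Printing Implicit Defensive.

Import GRing.Theory.
Local Open Scope ring_scope.

(** Write [u = x^a], [v = y^b], [m] for the middle generator, [J = (u, v)] and
    [I = (u, m, v)].  Since [I = J + (m)], expanding a power gives
    [I^(s+1) = J I^s + (m^(s+1))], so [I^(s+1) = J I^s] exactly when
    [m^(s+1)] lies in [J I^s] ([exp_eq_mulP]).  It remains to find the least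
    such [s].

    Put [q = g / gcd(e, g)] and [p = e / gcd(e, g)].  The exponent of [m] is the
    point of the segment from that of [v] to that of [u] that divides it in
    the ratio [e : g - e], whence [m^q = u^p v^(q - p)]; as [p > 0], this lies
    in [J I^(q-1)].

    Conversely [J I^s] is a monomial ideal, so if it contains [m^(s+1)] then
    some [u^i m^j v^l] with [i + j + l = s + 1] and [i + l > 0] divides
    [m^(s+1)] ([supported_mul_exp]).  Both monomials lie on the same dilate of
    the segment, so divisibility forces equality, and comparing the exponents
    of [x] yields [g i = e (i + l)].  Hence [q] divides [i + l], which is
    positive and at most [s + 1] ([exp_mid_mem]). *)

(** * Ideal arithmetic *)

Section IdealArithmetic.

Variable R : comNzRingType.
Implicit Types (A B : R -> Prop) (f h u m v : R).

Lemma ideal_gen2P u v f :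
  ideal_gen [:: u; v] f <-> exists c d, f = c * u + d * v.
Proof.
split=> [[c ->]|[c [d ->]]].
  by do 2 eexists; rewrite big_ord_recl big_ord1.
exists (fun i => nth 0 [:: c; d] i).
by rewrite big_ord_recl big_ord1.
Qed.

Lemma ideal_gen3P u m v f :
  ideal_gen [:: u; m; v] f <-> exists c d k, f = c * u + d * m + k * v.
Proof.
split=> [[c ->]|[c [d [k ->]]]].
  by do 3 eexists; rewrite !big_ord_recl big_ord0 addr0 addrA.
exists (fun i => nth 0 [:: c; d; k] i).
by rewrite !big_ord_recl big_ord0 /= addr0 addrA.
Qed.

Lemma ideal_mul0 A B : ideal_mul A B 0.
Proof.
by exists 0%N, (fun=> 0), (fun=> 0); split=> [[]|]; rewrite ?big_ord0.
Qed.

Lemma ideal_mul_mem A B f h : A f -> B h -> ideal_mul A B (f * h).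
Proof.
by move=> Af Bh; exists 1%N, (fun=> f), (fun=> h); rewrite big_ord1.
Qed.

Lemma ideal_mulD A B f h :
  ideal_mul A B f -> ideal_mul A B h -> ideal_mul A B (f + h).
Proof.
move=> [n1 [u1 [v1 [AB1 ->]]]] [n2 [u2 [v2 [AB2 ->]]]].
exists (n1 + n2)%N,
  (fun i => match split i with inl j => u1 j | inr j => u2 j end),
  (fun i => match split i with inl j => v1 j | inr j => v2 j end).
split=> [i|]; first by case: (split i).
rewrite big_split_ord /=; congr (_ + _); apply: eq_bigr => i _.
  by rewrite (unsplitK (inl i)).
by rewrite (unsplitK (inr i)).
Qed.

Lemma ideal_mul_sum A B n (F : 'I_n -> R) :
  (forall i, ideal_mul A B (F i)) -> ideal_mul A B (\sum_(i < n) F i).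
Proof.
move=> ABF; elim/big_ind: _ => //; first exact: ideal_mul0.
exact: ideal_mulD.
Qed.

Lemma ideal_mulSl A A' B f :
  (forall h, A h -> A' h) -> ideal_mul A B f -> ideal_mul A' B f.
Proof.
move=> sAA' [n [u [v [AB ->]]]]; exists n, u, v; split=> // i.
by have [/sAA'] := AB i.
Qed.

Lemma ideal_mulZl A B c f :
  (forall h, A h -> A (c * h)) -> ideal_mul A B f -> ideal_mul A B (c * f).
Proof.
move=> AZ [n [u [v [AB ->]]]]; rewrite mulr_sumr.
apply: ideal_mul_sum => i; rewrite mulrA; have [Au Bv] := AB i.
by apply: ideal_mul_mem => //; apply: AZ.
Qed.

Lemma ideal_exp_expr A f n : A f -> ideal_exp A n (f ^+ n).
Proof.
move=> Af; elim: n => [//|n IHn]; rewrite exprS.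
exact: ideal_mul_mem.
Qed.

Lemma ideal_exp_exprM A f h i j :
  A f -> A h -> ideal_exp A (i + j) (f ^+ i * h ^+ j).
Proof.
move=> Af Ah; elim: i => [|i IHi]; first by rewrite mul1r; apply: ideal_exp_expr.
by rewrite exprS -mulrA; apply: ideal_mul_mem.
Qed.

End IdealArithmetic.

Section ThreeGenerators.

Variable R : comNzRingType.
Variables u m v : R.
Local Notation J := (ideal_gen [:: u; v]).
Local Notation I := (ideal_gen [:: u; m; v]).

Lemma mem_gen3_left : I u.
Proof. by apply/ideal_gen3P; exists 1, 0, 0; ring. Qed.

Lemma mem_gen3_mid : I m.
Proof. by apply/ideal_gen3P; exists 0, 1, 0; ring. Qed.

Lemma mem_gen3_right : I v.
Proof. by apply/ideal_gen3P; exists 0, 0, 1; ring. Qed.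

Lemma mem_gen2_left : J u.
Proof. by apply/ideal_gen2P; exists 1, 0; ring. Qed.

Lemma gen2_sub_gen3 f : J f -> I f.
Proof.
move=> /ideal_gen2P[c [d ->]]; apply/ideal_gen3P.
by exists c, 0, d; ring.
Qed.

Lemma gen2_mulZ A c f : ideal_mul J A f -> ideal_mul J A (c * f).
Proof.
apply: ideal_mulZl => h /ideal_gen2P[k [l ->]]; apply/ideal_gen2P.
by exists (c * k), (c * l); ring.
Qed.

(** In the expansion of an element of [I^n], the only products of generators
    with no factor in [J] are multiples of [m^n].  At [n = 0] the predecessor
    is harmless, since the remainder can be taken to be [0]. *)
Lemma gen3_exp_decomp n f :
  ideal_exp I n f -> exists c, ideal_mul J (ideal_exp I n.-1) (f - c * m ^+ n).
Proof.
elim: n f => [|n IHn] f.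
  by move=> _; exists f; rewrite mulr1 subrr; apply: ideal_mul0.
move=> [k [w [z [Iwz ->]]]] /=.
have term i : exists c, ideal_mul J (ideal_exp I n) (w i * z i - c * m ^+ n.+1).
  have [/ideal_gen3P[al [be [ga ->]]] Iz] := Iwz i.
  have [c [l [p [s [Jps Ezi]]]]] := IHn _ Iz.
  exists (be * c).
  have -> : (al * u + be * m + ga * v) * z i - be * c * m ^+ n.+1
     = (al * u + ga * v) * z i + be * (m * (z i - c * m ^+ n)).
    by rewrite exprS; ring.
  apply: ideal_mulD.
    by apply: ideal_mul_mem => //; apply/ideal_gen2P; exists al, ga.
  apply: gen2_mulZ; rewrite Ezi mulr_sumr; apply: ideal_mul_sum => j.
  have [Jp Is] := Jps j; rewrite mulrCA; apply: ideal_mul_mem => //.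
  (* For n = 0 the power I^n is the whole ring. *)
  case: (n) Is => [//|n'] /= Is.
  exact: ideal_mul_mem mem_gen3_mid Is.
have [c Hc] := fin_all_exists term.
exists (\sum_i c i); rewrite mulr_suml -sumrB.
exact: ideal_mul_sum.
Qed.

(** The two ideals differ at most by the multiples of [m^(s+1)]. *)
Lemma exp_eq_mulP s :
  ideal_eq (ideal_exp I s.+1) (ideal_mul J (ideal_exp I s)) <->
  ideal_mul J (ideal_exp I s) (m ^+ s.+1).
Proof.
split=> [eqIJ | Jm f].
  by apply/eqIJ; apply: ideal_exp_expr; apply: mem_gen3_mid.
split=> [/gen3_exp_decomp[c Jf] | ]; last exact/ideal_mulSl/gen2_sub_gen3.
rewrite -(subrK (c * m ^+ s.+1) f); apply: ideal_mulD => //.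
exact: gen2_mulZ.
Qed.

End ThreeGenerators.

(** * Supports of polynomials in monomial ideals *)

Section Support.

Variables (n : nat) (R : nzRingType).
Implicit Types (U V W : 'X_{1..n} -> Prop) (f h : {mpoly R[n]}).

(** When [U] is closed under adding arbitrary exponents, this is membership in the
    monomial ideal spanned by the monomials with exponent in [U]. *)
Definition supported U f := forall k, k \in msupp f -> U k.

Lemma supported_sum U r (F : 'I_r -> {mpoly R[n]}) :
  (forall i, supported U (F i)) -> supported U (\sum_(i < r) F i).
Proof.
move=> UF; elim/big_ind: _ => // [k|f h Uf Uh k].
  by rewrite msupp0.
by move/msuppD_le; rewrite mem_cat => /orP[/Uf|/Uh].
Qed.

Lemma supportedM U V W f h :
    (forall k l, U k -> V l -> W (k + l)%MM) ->
  supported U f -> supported V h -> supported W (f * h).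
Proof.
move=> UVW Uf Vh k /msuppM_le /allpairsP[[k1 k2] /= [/Uf Uk1 /Vh Vk2 ->]].
exact: UVW.
Qed.

Lemma supportedX U k : U k -> supported U 'X_[R, k].
Proof. by move=> Uk l /[!msuppX] /[!inE] /eqP->. Qed.

End Support.

Lemma supported_ideal_mul (n : nat) (R : comNzRingType)
    (U V W : 'X_{1..n} -> Prop) (A B : {mpoly R[n]} -> Prop) f :
    (forall k l, U k -> V l -> W (k + l)%MM) ->
    (forall h, A h -> supported U h) -> (forall h, B h -> supported V h) ->
  ideal_mul A B f -> supported W f.
Proof.
move=> UVW AU BV [r [w [z [ABwz ->]]]]; apply: supported_sum => i.
by have [/AU Uw /BV Vz] := ABwz i; apply: (supportedM UVW).
Qed.

Section MonomialGenerators.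

Variables (K : fieldType) (a b c d : nat).
Local Notation x := (varx K).
Local Notation y := (vary K).
Local Notation u := (x ^+ a).
Local Notation m := (x ^+ c * y ^+ d).
Local Notation v := (y ^+ b).
Local Notation J := (ideal_gen [:: u; v]).
Local Notation I := (ideal_gen [:: u; m; v]).

Definition mon2 (i j : nat) : 'X_{1..2} := (U_(ord0) *+ i + U_(ord_max) *+ j)%MM.

Lemma mon2_0 i j : mon2 i j ord0 = i.
Proof. by rewrite mnmDE !mulmnE !mnm1E /= mul1n mul0n addn0. Qed.

Lemma mon2_1 i j : mon2 i j ord_max = j.
Proof. by rewrite mnmDE !mulmnE !mnm1E /= mul1n mul0n. Qed.

Lemma mpolyX_mon2 i j : 'X_[K, mon2 i j] = x ^+ i * y ^+ j.
Proof. by rewrite mpolyXD !mpolyXn. Qed.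

(** These are the exponents of the multiples of the products [u^i m^j v^l] of [n]
    generators of which at least [t] lie in [J]. *)
Definition above n t (k : 'X_{1..2}) := exists i j l,
  [/\ (i + j + l = n)%N, (t <= i + l)%N, (a * i + c * j <= k ord0)%N
    & (d * j + b * l <= k ord_max)%N].

Lemma aboveD n1 t1 n2 t2 k1 k2 :
  above n1 t1 k1 -> above n2 t2 k2 -> above (n1 + n2) (t1 + t2) (k1 + k2)%MM.
Proof.
move=> [i1 [j1 [l1 [? ? ? ?]]]] [i2 [j2 [l2 [? ? ? ?]]]].
by exists (i1 + i2)%N, (j1 + j2)%N, (l1 + l2)%N; rewrite !mnmDE; split; nia.
Qed.

Lemma above00 k : above 0 0 k.
Proof. by exists 0%N, 0%N, 0%N; rewrite !muln0. Qed.

Lemma supported_above00 f : supported (above 0 0) (f : {mpoly K[2]}).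
Proof. by move=> k _; apply: above00. Qed.

Lemma supported_multiple n t i j f :
  above n t (mon2 i j) -> supported (above n t) (f * (x ^+ i * y ^+ j)).
Proof.
move=> Hij; rewrite -mpolyX_mon2.
apply: (supportedM (U := above 0 0) (V := above n t)) (supportedX _) => //.
  exact: (@aboveD 0 0).
exact: supported_above00.
Qed.

Lemma above_left : above 1 1 (mon2 a 0).
Proof. by exists 1%N, 0%N, 0%N; rewrite mon2_0 mon2_1; split; lia. Qed.

Lemma above_right : above 1 1 (mon2 0 b).
Proof. by exists 0%N, 0%N, 1%N; rewrite mon2_0 mon2_1; split; lia. Qed.

Lemma above_mid : above 1 0 (mon2 c d).
Proof. by exists 0%N, 1%N, 0%N; rewrite mon2_0 mon2_1; split; lia. Qed.

Lemma above_weaken n t k : above n t k -> above n 0 k.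
Proof. by move=> [i [j [l [? ? ? ?]]]]; exists i, j, l. Qed.

Lemma supported_gen2 f : J f -> supported (above 1 1) f.
Proof.
move=> [w ->]; apply: supported_sum => -[[|[|//]] lt_i] /=.
  by rewrite -[x ^+ a]mulr1 -(expr0 y); apply/supported_multiple/above_left.
by rewrite -[y ^+ b]mul1r -(expr0 x); apply/supported_multiple/above_right.
Qed.

Lemma supported_gen3 f : I f -> supported (above 1 0) f.
Proof.
move=> [w ->]; apply: supported_sum => -[[|[|[|//]]] lt_i] /=.
- rewrite -[x ^+ a]mulr1 -(expr0 y).
  exact/supported_multiple/above_weaken/above_left.
- exact/supported_multiple/above_mid.
- rewrite -[y ^+ b]mul1r -(expr0 x).
  exact/supported_multiple/above_weaken/above_right.
Qed.

Lemma supported_exp n f : ideal_exp I n f -> supported (above n 0) f.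
Proof.
elim: n f => [|n IHn] f; first by move=> _; apply: supported_above00.
by apply: supported_ideal_mul supported_gen3 IHn; apply: (@aboveD 1 0 n 0).
Qed.

Lemma supported_mul_exp s f :
  ideal_mul J (ideal_exp I s) f -> supported (above s.+1 1) f.
Proof.
apply: supported_ideal_mul supported_gen2 (@supported_exp s).
exact: (@aboveD 1 1 s 0).
Qed.

(** The hypothesis says that the exponent [(c, d)] lies on the line through
    [(a, 0)] and [(0, b)].  The linear form [b X + a Y] takes the value
    [(s + 1) a b] at the exponents of both [m^(s+1)] and [u^i m^j v^l], so the
    coordinatewise inequality between them is an equality. *)
Lemma exp_mid_mem s :
    (0 < a)%N -> (0 < b)%N -> (b * c + a * d = a * b)%N ->
    ideal_mul J (ideal_exp I s) (m ^+ s.+1) ->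
  exists i l, [/\ (0 < i + l)%N, (i + l <= s.+1)%N & (a * i = c * (i + l))%N].
Proof.
move=> a_gt0 b_gt0 on_line /supported_mul_exp.
rewrite exprMn -!exprM -mpolyX_mon2 => /(_ (mon2 (c * s.+1) (d * s.+1))).
rewrite msuppX inE eqxx => /(_ isT) [i [j [l [Dn il_gt0]]]].
rewrite mon2_0 mon2_1 -Dn => le_x le_y.
exists i, l; split=> //; first by lia.
have le_x' : (a * i <= c * (i + l))%N by nia.
have le_y' : (b * l <= d * (i + l))%N by nia.
apply/eqP; rewrite eqn_leq le_x' /= -(leq_pmul2l b_gt0).
have : (a * (b * l) <= a * (d * (i + l)))%N by rewrite leq_mul2l le_y' orbT.
have : ((b * c + a * d) * (i + l) = a * b * (i + l))%N by rewrite on_line.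
by rewrite !mulnDl !mulnDr; lia.
Qed.

End MonomialGenerators.

(** * The reduction number *)

Theorem proposition3p3 (K : fieldType) (a b e : nat) :
  let g := gcdn a b in
  let x := varx K in
  let y := vary K in
  (0 < a)%N -> (0 < b)%N -> (1 <= e <= g - 1)%N ->
  is_reduction_number
    (ideal_gen [:: x ^+ a; y ^+ b])
    (ideal_gen [:: x ^+ a;
                   x ^+ (e * (a %/ g))%N * y ^+ (b - e * (b %/ g))%N;
                   y ^+ b])
    (g %/ gcdn e g - 1)%N.
Proof.
move=> g x y a_gt0 b_gt0 /andP[e_gt0 e_le].
have g_gt0 : (0 < g)%N by rewrite gcdn_gt0 a_gt0.
have [Da Db] : (a = a %/ g * g /\ b = b %/ g * g)%N.
  by rewrite !divnK ?dvdn_gcdl ?dvdn_gcdr.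
have d_gt0 : (0 < gcdn e g)%N by rewrite gcdn_gt0 e_gt0.
have [De Dg] : (e = e %/ gcdn e g * gcdn e g /\ g = g %/ gcdn e g * gcdn e g)%N.
  by rewrite !divnK ?dvdn_gcdl ?dvdn_gcdr.
have co_pq : coprime (e %/ gcdn e g) (g %/ gcdn e g).
  by rewrite /coprime -(eqn_pmul2r d_gt0) mul1n muln_gcdl -De -Dg.
clearbody g; move: (a %/ g)%N (b %/ g)%N Da Db => a1 b1 Da Db.
move: (e %/ gcdn e g)%N (g %/ gcdn e g)%N De Dg co_pq => p q De Dg co_pq.
move: (gcdn e g) De Dg d_gt0 => dd De Dg d_gt0.
have p_gt0 : (0 < p)%N by move: e_gt0; rewrite De muln_gt0 => /andP[].
have p_lt : (p < q)%N by rewrite -(ltn_pmul2r d_gt0) -De -Dg; lia.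
have a1_gt0 : (0 < a1)%N by move: a_gt0; rewrite Da muln_gt0 => /andP[].
split=> [|s].
  apply/exp_eq_mulP; rewrite subn1 prednK; last by lia.
  (* m^q = u^p v^(q - p), with one factor u split off as the factor in J. *)
  have -> : (x ^+ (e * a1) * y ^+ (b - e * b1)) ^+ q
     = x ^+ a * ((x ^+ a) ^+ p.-1 * (y ^+ b) ^+ (q - p)).
    rewrite mulrA -exprS prednK // exprMn -!exprM.
    congr (_ ^+ _ * _ ^+ _); first by rewrite Da Dg De; ring.
    by rewrite mulnBl mulnBr Db Dg De; congr (_ - _)%N; ring.
  apply: ideal_mul_mem; first exact: mem_gen2_left.
  have -> : q.-1 = (p.-1 + (q - p))%N by lia.
  by apply: ideal_exp_exprM; [apply: mem_gen3_left|apply: mem_gen3_right].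
move=> /exp_eq_mulP /exp_mid_mem[//|//||i [l [il_gt0 il_le]]].
  have le_eb : (e * b1 <= b)%N by rewrite Db mulnC leq_mul2l; lia.
  rewrite mulnBr; have : (a * (e * b1) <= a * b)%N by rewrite leq_mul2l le_eb orbT.
  suff -> : (b * (e * a1) = a * (e * b1))%N by lia.
  by rewrite Da Db; ring.
(* Dividing a i = e a1 (i + l) by a1 gcd(e, g) leaves q i = p (i + l). *)
have -> : (a * i = a1 * dd * (q * i))%N by rewrite Da Dg; ring.
have -> : (e * a1 * (i + l) = a1 * dd * (p * (i + l)))%N by rewrite De; ring.
move/eqP; rewrite eqn_pmul2l ?muln_gt0 ?a1_gt0 // => /eqP Dqi.
have : (q %| i + l)%N.
  by rewrite -(Gauss_dvdr (m := q) (n := p)) 1?coprime_sym // -Dqi dvdn_mulr.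
by move=> /(dvdn_leq il_gt0); lia.
Qed.
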